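(* Let $k\ge 1$ and $n\ge 1$ be integers and let $a$ be a positive integer or $a=\infty$. The map $\phi$ (defined in the context) is a bijection from the set $\mathcal{PM}^{k+1}_n(k,a)$ of $(k+1)$-hump colored $(k,a)$-paths of order $n$ onto the set $\mathcal{S}'_n(k,a)$ of super $(k,a)$-paths of order $n$ having at least one up step. Moreover, for every $P\in\mathcal{PM}^{k+1}_n(k,a)$ whose colored hump is $UH^{l}D$ (with $l\ge 0$), the super $(k,a)$-path $\phi(P)$ starts with exactly $l$ consecutive horizontal steps.
   Context: Paths. A $(k,a)$-path of order $n$ is a lattice path in $\mathbb{Z}\times\mathbb{Z}$ from $(0,0)$ to $(n,0)$ using up steps $U=(1,k)$, down steps $D=(1,-1)$ and horizontal steps $H=(a,0)$ and never going below the $x$-axis; for $a=\infty$ no horizontal steps are allowed. A super $(k,a)$-path of order $n$ is defined in the same way except that it is allowed to go below the $x$-axis. Paths are identified with words in the letters $U,D,H$. A section of a path is called a (possibly empty) $(k,a)$-path if its word is the word of a $(k,a)$-path, i.e. it starts and ends at the same height and never goes below that height. The reverse $\widehat{P}$ of a word $P=p_1p_2\cdots p_N$ is the word $p_N\cdots p_2p_1$. $H^{i}$ denotes $i$ consecutive horizontal steps. Humps and colorings. A hump in a path is an up step followed by zero or more horizontal steps followed by a down step (all consecutive), i.e. an occurrence of a factor $UH^{j}D$, $j\ge 0$. An $m$-hump colored $(k,a)$-path is a $(k,a)$-path in which exactly one hump is selected and assigned one of the $m$ colors $1,\dots,m$ (i.e. a triple consisting of a path, one of its humps, and a color). $\mathcal{PM}^{m}_n(k,a)$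 is the set of all $m$-hump colored $(k,a)$-paths of order $n$. $\mathcal{S}'_n(k,a)$ is the set of all super $(k,a)$-paths of order $n$ having at least one up step. The map $\phi$. Let $P=p_1p_2\cdots p_N\in\mathcal{PM}^{k+1}_n(k,a)$ have colored hump $p_l p_{l+1}\cdots p_m=UH^{m-l-1}D$ with color $c\in\{1,\dots,k+1\}$, and suppose $p_l$ goes from $(x_1,h)$ to $(x_1+1,h+k)$, where $x_1,h\ge 0$. Then $P$ can be uniquely decomposed as $$P=R_1\,P'\,p_l\,H^{m-l-1}\,d_1\,R_2\,d_2\cdots R_k\,d_k\,P'',$$ where: for $1\le i\le k$, $d_i$ is the first step after $p_l$ that goes from the line $y=h+k+1-i$ to the line $y=h+k-i$ (so it is a down step); $P'$ is the (possibly empty) section of $P$ immediately to the left of $p_l$ which, when nonempty, starts with an up step on the $x$-axis and lies strictly above the $x$-axis except for its starting point; each $R_i$ is a (possibly empty) $(k,a)$-path; and $P''$ is the remaining section of $P$ after $d_k$ (going from height $h$ to the $x$-axis). The word $\phi(P)$, viewed as a path starting at $(0,0)$, is defined as follows: (i) if $c=1$, $\phi(P)=H^{m-l-1}\,p_l\,R_1d_1R_2d_2\cdots R_kd_k\,P''P'$; (ii) if $c=k+1$, $\phi(P)=H^{m-l-1}\,d_1\widehat{R_1}\,d_2\widehat{R_2}\cdots d_k\widehat{R_k}\,p_l\,P''P'$; (iii) if $1<c<k+1$, $\phi(P)=H^{m-l-1}\,d_1\widehat{R_1}\,d_2\widehat{R_2}\cdots d_{c-1}\widehat{R_{c-1}}\,p_l\,R_cd_c\cdots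 R_kd_k\,P''P'$. *)

(* Defs.v *)
From HB Require Import structures.
From mathcomp Require Import all_boot all_order all_algebra.
From mathcomp Require Import boolp classical_sets functions.

Set Implicit Arguments.
Unset Strict Implicit.
Unset Printing Implicit Defensive.

Import Order.TTheory GRing.Theory Num.Theory.

Local Open Scope nat_scope.
Local Open Scope classical_set_scope.

Inductive step := U | D | H.

Definition step_eqb (s t : step) : bool :=
  match s, t with U, U | D, D | H, H => true | _, _ => false end.

Lemma step_eqP : Equality.axiom step_eqb.
Proof. by case=> [] []; constructor. Qed.

HB.instance Definition _ := hasDecEq.Build step step_eqP.

Definition word := seq step.

(* The parameter a is [Some b] for a = b and [None] for a = oo; in the latter
   case [xstep None H] is irrelevant, because [allowed] excludes H. *)
Definition xstep (a : option nat) (s : step) : nat :=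
  if s is H then odflt 0 a else 1.

Definition ystep (k : nat) (s : step) : int :=
  match s with U => k%:Z | D => (- 1)%R | H => 0%R end.

Definition width (a : option nat) (w : word) : nat := \sum_(s <- w) xstep a s.

Definition height (k : nat) (w : word) : int := (\sum_(s <- w) ystep k s)%R.

Definition allowed (a : option nat) (w : word) : Prop :=
  a = None -> H \notin w.

Definition super_path (k : nat) (a : option nat) (n : nat) (w : word) : Prop :=
  [/\ allowed a w, width a w = n & height k w = 0%R].

Definition ka_path (k : nat) (a : option nat) (n : nat) (w : word) : Prop :=
  super_path k a n w /\ forall i : nat, (0 <= height k (take i w))%R.

(* The factor U H^j D occurs in w after the first p steps. *)
Definition hump_at (w : word) (p j : nat) : Prop :=
  exists u v : word, size u = p /\ w = u ++ U :: nseq j H ++ D :: v.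

(* A word, an occurrence U H^hlen D in it after the first hpos steps, and a
   color in 1, ..., m (these constraints are in [PM]). *)
Record colored_path := ColoredPath {
  cword : word;
  hpos : nat;
  hlen : nat;
  color : nat }.

Definition PM (m n k : nat) (a : option nat) : set colored_path :=
  [set P | [/\ ka_path k a n (cword P), hump_at (cword P) (hpos P) (hlen P)
             & 1 <= color P <= m]].

Definition S' (n k : nat) (a : option nat) : set word :=
  [set w | super_path k a n w /\ U \in w].

(* Steps are indexed from 0: step t of w goes from height [ht k w t] to height
   [ht k w t.+1]. *)
Definition ht (k : nat) (w : word) (t : nat) : int := height k (take t w).

(* The steps of w with indices s, ..., t - 1. *)
Definition section (w : word) (s t : nat) : word := drop s (take t w).

Section Decomposition.

Variables (k : nat) (w : word) (l : nat).

(* P' starts at the last visit to the x-axis not after the beginning of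
   step l. *)
Definition start_P' : nat := last 0 [seq t <- iota 0 l.+1 | ht k w t == 0%R].

(* Index of d_i: the first step after step l from height h + k + 1 - i to
   height h + k - i, where h = ht k w l. *)
Definition dpos (i : nat) : nat :=
  l.+1 + find (fun t => (ht k w t == ht k w l + k%:Z + 1 - i%:Z)%R
                     && (ht k w t.+1 == ht k w l + k%:Z - i%:Z)%R)
              (iota l.+1 (size w - l.+1)).

Definition R_ (i : nat) : word :=
  if i == 1 then take start_P' w else section w (dpos i.-1).+1 (dpos i).

Definition P'_ : word := section w start_P' l.

Definition P''_ : word := drop (dpos k).+1 w.

(* d_s rev(R_s) ... d_(t-1) rev(R_(t-1)) *)
Definition rev_blocks (s t : nat) : word :=
  flatten [seq D :: rev (R_ i) | i <- index_iota s t].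

(* R_s d_s ... R_(t-1) d_(t-1) *)
Definition blocks (s t : nat) : word :=
  flatten [seq rcons (R_ i) D | i <- index_iota s t].

End Decomposition.

Definition phi (k : nat) (P : colored_path) : word :=
  let: ColoredPath w l j c := P in
  nseq j H ++
  (if c == 1 then U :: blocks k w l 1 k.+1
   else if c == k.+1 then rcons (rev_blocks k w l 1 k.+1) U
   else rev_blocks k w l 1 c ++ U :: blocks k w l c k.+1) ++
  P''_ k w l ++ P'_ k w l.

Definition starts_with_exactly (j : nat) (w : word) : Prop :=
  exists v : word, w = nseq j H ++ v /\ ohead v <> Some H.

(* Main.v *)
Require Import Defs.
From mathcomp Require Import all_boot all_order all_algebra.
From mathcomp Require Import boolp classical_sets functions.
From mathcomp Require Import zify.

(** Both sides of the bijection are assembled from the same free data: k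
excursions R_1, ..., R_k (paths that start and end at the same height and never
go below it), two words P' and P'', a number j of horizontal steps and a color
c. The word P' stays above its starting point after its first letter, no prefix
of P'' ends lower than P'' itself, and the heights of P' and P'' cancel.

A hump colored path is R_1 P' U H^j D R_2 D ... R_k D P'' with the hump U H^j D
marked; [phi] sends it to H^j D rev(R_1) ... D rev(R_(c-1)) U R_c D ... R_k D
P'' P'. In this last word the three cases of the definition of [phi] merge,
because a descent with no excursion in it is the empty word. So it suffices to
show that the gluing of hump colored paths is onto, that the gluing of super
paths is bijective, and that [phi] carries the first to the second.

On the side of the paths, R_1 ends and P' begins at the last minimum of the
part before the hump, a minimum that lies on the x-axis ([last_min_split]), and
the remaining R_i are cut out by the first passages to successively lower levels
after the hump ([descent_exists]).

On the side of the super paths, remove the leading H's. What remains starts with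
U or D, and stays strictly below the axis (for no step at all, if it starts with
U) until an up step brings it to height at least 0: this is the step U of the
hump ([crossing_split]). The
part before this step, read backwards, is again a word that reaches its final
level only at its end, that is, a descent through excursions; its depth c - 1 is
at most k, and so it recovers the color ([negative_rev_descent]). After U the
path is at height k - c + 1, and first passages down to height 0 give R_c, ...,
R_k. The tail that follows has height 0, and is cut into P'' and P' at its last
minimum. Every cut is forced, which gives injectivity ([super_glue_inj]).

The glued words use the same letters, so width, height and the absence of H need
to be checked on one side only ([perm_glue]). Finally [phi_hump_glue] checks
that the cuts made by [phi] are the gluing points. *)

Set Implicit Arguments.
Unset Strict Implicit.
Unset Printing Implicit Defensive.

Import Order.TTheory GRing.Theory Num.Theory.

(** * Heights of prefixes *)

Implicit Types (w u v x y z T R : word) (s : step) (rs : seq word).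

Lemma height_nil k : height k [::] = 0%R.
Proof. by rewrite /height big_nil. Qed.

Lemma height_cons k s w : height k (s :: w) = (ystep k s + height k w)%R.
Proof. by rewrite /height big_cons. Qed.

Lemma height_cat k u v : height k (u ++ v) = (height k u + height k v)%R.
Proof. by rewrite /height big_cat. Qed.

Lemma height_rev k w : height k (rev w) = height k w.
Proof. by rewrite /height (perm_big w) //= perm_rev. Qed.

Lemma height_nseqH k j : height k (nseq j H) = 0%R.
Proof. by elim: j => [|j IH]; rewrite ?height_nil ?height_cons ?IH. Qed.

Definition heightE k := (height_cat k, height_cons k, height_nil k,
  height_rev k, height_nseqH k).

Definition above k (h : int) w := forall i, (0 <= h + height k (take i w))%R.

Definition excursion k w := height k w = 0%R /\ above k 0 w.

Definition positive k w :=
  forall i, 0 < i <= size w -> (0 < height k (take i w))%R.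

Definition ends_low k w := forall i, (height k w <= height k (take i w))%R.

Lemma above_cat k h u v :
  above k h (u ++ v) <-> above k h u /\ above k (h + height k u)%R v.
Proof.
split=> [A|[Au Av] i].
  split=> i.
    have [le_iu|lt_ui] := leqP i (size u).
      by have := A i; rewrite takel_cat.
    have := A (size u); rewrite take_size_cat // take_oversize //; lia.
  have := A (size u + i); rewrite take_cat ltnNge leq_addr /= addKn heightE.
  by rewrite GRing.addrA.
rewrite take_cat; case: ltnP => _; first exact: Au.
by rewrite heightE GRing.addrA.
Qed.

Lemma above_cons k h s v :
  above k h (s :: v) <-> (0 <= h)%R /\ above k (h + ystep k s)%R v.
Proof.
split=> [A|[h0 A] [|i]].
- split; first by have := A 0; rewrite take0 heightE; lia.
  by move=> i; have := A i.+1; rewrite /= heightE GRing.addrA.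
- by rewrite take0 heightE; lia.
- by rewrite /= heightE GRing.addrA.
Qed.

Lemma above_weaken k h h' w : (h <= h')%R -> above k h w -> above k h' w.
Proof. by move=> hh' A i; have := A i; lia. Qed.

Lemma excursion_nseqH k j : excursion k (nseq j H).
Proof.
split; first exact: height_nseqH.
move=> i; have [le_ij|lt_ji] := leqP i j.
  by rewrite take_nseq // height_nseqH.
by rewrite take_oversize ?size_nseq ?height_nseqH // ltnW.
Qed.


Definition negative k w :=
  forall i, 0 < i <= size w -> (height k (take i w) < 0)%R.

(** * Cutting words at minima and first passages *)

Lemma cat_split (T : Type) (u v u' v' : seq T) :
  u ++ v = u' ++ v' -> size u <= size u' ->
  exists z : seq T, u' = u ++ z /\ v = z ++ v'.
Proof.
move=> e le_u; exists (drop (size u) u').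
have eu : take (size u) u' = u by rewrite -(takel_cat v') // -e take_size_cat.
split; first by rewrite -{1}(cat_take_drop (size u) u') eu.
have := congr1 (drop (size u)) e; rewrite drop_size_cat // => ->.
move: le_u; rewrite drop_cat leq_eqVlt => /predU1P[->|->//].
by rewrite ltnn subnn drop0 drop_size.
Qed.

Lemma positive_prefix k u v : positive k (u ++ v) -> u != [::] ->
  (0 < height k u)%R.
Proof.
move=> pos u0; have := pos (size u); rewrite take_size_cat // size_cat leq_addr.
by rewrite lt0n size_eq0 u0; apply.
Qed.

Lemma positive_above k w : positive k w -> above k 0 w.
Proof.
move=> pos i; rewrite GRing.add0r -[w in take i w]take_size -take_min.
have := pos (minn i (size w)); rewrite geq_minr andbT.
by case: (minn _ _) => [|e] => [_|/(_ isT) /ltW //]; rewrite take0 heightE.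
Qed.

(** Induction from the front: a letter put before a split word either joins the
left part, or, when the left part would then end above its start, moves the
last minimum to the very beginning. *)
Lemma last_min_split k T :
  exists x y, [/\ T = x ++ y, ends_low k x & positive k y].
Proof.
elim: T => [|s T [x [y [-> low pos]]]].
  by exists [::], [::]; split=> // -[|i].
have [le0|gt0] := leP (height k (s :: x)) 0%R.
  exists (s :: x), y; split=> // -[|i]; first by rewrite take0 height_nil.
  by rewrite /= !heightE; have := low i; lia.
exists [::], (s :: x ++ y); split=> // -[|i] //= le_i.
move: gt0; rewrite !heightE => gt0.
have [lt_ix|le_xi] := ltnP i (size x).
  by rewrite takel_cat 1?ltnW //; have := low i; lia.
rewrite take_cat ltnNge le_xi /= heightE.
have [->|ne_ix] := eqVneq i (size x); first by rewrite subnn take0 heightE; lia.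
have := pos (i - size x); move: le_i; rewrite /= size_cat; lia.
Qed.

(** If one left part were longer, the excess would have to rise strictly, being
a prefix of a positive word, and yet not rise, since its end is a minimum. *)
Lemma last_min_split_inj k x y x' y' :
  ends_low k x -> positive k y -> ends_low k x' -> positive k y' ->
  x ++ y = x' ++ y' -> x = x' /\ y = y'.
Proof.
wlog le_x : x y x' y' / size x <= size x' => [wl|].
  move=> lx py lx' py' e; have [le_x|lt_x] := leqP (size x) (size x').
    exact: wl.
  by have [] := wl _ _ _ _ (ltnW lt_x) lx' py' lx py (esym e).
move=> _ py lx' _ /cat_split /(_ le_x) [z [ex' ey]].
suff z0 : z = [::] by rewrite ex' ey z0 cats0.
apply/eqP/negPn/negP => /(positive_prefix (k := k) (v := y')).
rewrite -ey => /(_ py); have := lx' (size x).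
by rewrite ex' take_size_cat // heightE; lia.
Qed.

(** The shortest prefix of negative height ends with the only letter that
descends, and it descends by one: what precedes that D is an excursion. *)
Lemma first_passage k w :
  (height k w < 0)%R -> exists R v, excursion k R /\ w = R ++ D :: v.
Proof.
move=> w_neg.
have ex_i : exists i, (height k (take i w) < 0)%R.
  by exists (size w); rewrite take_size.
have [[|i] neg_i min_i] := ex_minnP ex_i; first by rewrite take0 heightE in neg_i.
have nonneg e : e <= i -> (0 <= height k (take e w))%R.
  by move=> le_ei; rewrite leNgt; apply/negP => /min_i; lia.
have lt_iw : i < size w.
  rewrite ltnNge; apply/negP => le_wi; have := nonneg i (leqnn i).
  by move: neg_i; rewrite !take_oversize //; lia.
have := neg_i; rewrite (take_nth D lt_iw) -cats1 !heightE.
have := nonneg i (leqnn i); case E : (nth D w i) => /= hi hi'; try lia.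
exists (take i w), (drop i.+1 w); split; last first.
  by rewrite -E -drop_nth // cat_take_drop.
split; first lia.
move=> e; rewrite GRing.add0r -take_min; apply: nonneg; exact: geq_minr.
Qed.

(** A longer excursion would contain the shorter one followed by D, which ends
below its start. *)
Lemma first_passage_inj k R v R' v' :
  excursion k R -> excursion k R' -> R ++ D :: v = R' ++ D :: v' ->
  R = R' /\ v = v'.
Proof.
wlog le_R : R v R' v' / size R <= size R' => [wl|].
  move=> xR xR' e; have [le_R|lt_R] := leqP (size R) (size R'); first exact: wl.
  by have [] := wl _ _ _ _ (ltnW lt_R) xR' xR (esym e).
move=> [R0 _] [_ aR'] /cat_split /(_ le_R) [[|s z] [eR' /=]].
  by case=> <-; rewrite eR' cats0.
case=> es _; have := aR' (size R).+1.
rewrite eR' -es -cat_rcons take_size_cat ?size_rcons //.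
by rewrite -cats1 !heightE /= R0.
Qed.

(** * Descents through excursions *)

Definition descent (rs : seq word) : word := flatten [seq rcons R D | R <- rs].

Definition rev_descent (rs : seq word) : word :=
  flatten [seq D :: rev R | R <- rs].

Lemma descent_cons R rs : descent (R :: rs) = R ++ D :: descent rs.
Proof. by rewrite /descent /= cat_rcons. Qed.

Lemma descent_cat rs rs' : descent (rs ++ rs') = descent rs ++ descent rs'.
Proof. by rewrite /descent map_cat flatten_cat. Qed.

Lemma rev_descentK rs : rev (rev_descent rs) = descent (rev rs).
Proof.
elim: rs => // R rs IH.
rewrite /rev_descent /= -/(rev_descent rs) -cat_cons rev_cat rev_cons revK IH.
by rewrite rev_cons -[rcons (rev rs) R]cats1 descent_cat /descent /= cats0.
Qed.

Section Descent.

Variable k : nat.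

Definition excursions rs := {in rs, forall R, excursion k R}.

Lemma excursions_cons R rs :
  excursions (R :: rs) <-> excursion k R /\ excursions rs.
Proof.
split=> [xs|[xR xs] R']; last by rewrite inE => /predU1P[->|/xs].
by split=> [|R' R'in]; apply: xs; rewrite inE ?eqxx ?R'in ?orbT.
Qed.

Lemma height_descent rs :
  excursions rs -> height k (descent rs) = (- (size rs)%:Z)%R.
Proof.
elim: rs => [|R rs IH]; first by rewrite heightE.
by case/excursions_cons=> -[R0 _] /IH; rewrite descent_cons !heightE /=; lia.
Qed.

Lemma above_descent rs :
  excursions rs -> above k (size rs)%:Z (descent rs).
Proof.
elim: rs => [|R rs IH]; first by move=> _ i; rewrite heightE.
case/excursions_cons=> -[R0 aR] /IH ad; rewrite descent_cons.
apply/above_cat; split; first by apply: above_weaken aR.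
apply/above_cons; split; first by rewrite R0; lia.
by apply: above_weaken ad; rewrite R0 /=; lia.
Qed.

(** The end of a descent is the first visit to its lowest level: this identifies
the steps d_i as first passages. *)
Lemma descent_prefix rs i : excursions rs -> i < size (descent rs) ->
  (- (size rs)%:Z < height k (take i (descent rs)))%R.
Proof.
elim: rs i => // R rs IH i /excursions_cons[[R0 aR] /IH{}IH].
rewrite descent_cons take_cat size_cat /=; case: (ltnP i (size R)) => [_ _|le_Ri lt_i].
  by have := aR i; lia.
case E : (i - size R) => [|e]; first by rewrite take0 !heightE R0; lia.
by rewrite /= !heightE R0 /=; have := IH e; lia.
Qed.

Lemma descent_exists r w : (height k w <= - r%:Z)%R ->
  exists rs v, [/\ size rs = r, excursions rs & w = descent rs ++ v].
Proof.
elim: r w => [|r IH] w hw; first by exists [::], w; split.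
have [|R [v [[R0 aR] ew]]] := @first_passage k w; first by lia.
have [|rs [v' [szrs xrs ev]]] := IH v.
  by move: hw; rewrite ew !heightE R0 /=; lia.
exists (R :: rs), v'; split; first by rewrite /= szrs.
  exact/excursions_cons.
by rewrite descent_cons ew ev -catA.
Qed.

Lemma descent_inj rs v rs' v' :
  excursions rs -> excursions rs' -> size rs = size rs' ->
  descent rs ++ v = descent rs' ++ v' -> rs = rs' /\ v = v'.
Proof.
elim: rs rs' => [|R rs IH] [|R' rs'] // /excursions_cons[xR xrs].
case/excursions_cons=> xR' xrs' [sz]; rewrite !descent_cons -!catA /=.
case/(first_passage_inj xR xR') => -> /IH.
by case/(_ xrs xrs' sz) => -> ->.
Qed.

Lemma excursions_rev rs : excursions rs -> excursions (rev rs).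
Proof. by move=> xs R; rewrite mem_rev; apply: xs. Qed.

Lemma height_rev_descent rs :
  excursions rs -> height k (rev_descent rs) = (- (size rs)%:Z)%R.
Proof.
move=> xrs; rewrite -height_rev rev_descentK height_descent ?size_rev //.
exact: excursions_rev.
Qed.

Lemma height_take_rev w i : height k (take i (rev w)) =
  (height k w - height k (take (size w - i) w))%R.
Proof.
rewrite take_rev height_rev.
by have := height_cat k (take (size w - i) w) (drop (size w - i) w);
  rewrite cat_take_drop; lia.
Qed.

Lemma rev_descent_negative rs : excursions rs -> negative k (rev_descent rs).
Proof.
move=> xrs i; rewrite -{2}[rev_descent rs]revK rev_descentK height_take_rev.
rewrite -(size_rev (rev_descent _)) rev_descentK => lt_i.
have xr := excursions_rev xrs.
rewrite height_descent //; have := @descent_prefix _ (size (descent (rev rs)) - i) xr.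
lia.
Qed.

(** Read backwards, a word that stays negative after its start reaches its
final height only at its end, so its descent to that level leaves no remainder.
*)
Lemma negative_rev_descent w : negative k w ->
  exists2 rs, excursions rs & w = rev_descent rs.
Proof.
move=> neg_w.
have hw0 : (height k w <= 0)%R.
  have [->|w0] := eqVneq w [::]; first by rewrite heightE.
  by have := neg_w (size w); rewrite take_size lt0n size_eq0 w0; lia.
have [|rs [v [sz xrs ew]]] := @descent_exists `|height k w|%N (rev w).
  by rewrite height_rev; lia.
exists (rev rs); first exact: excursions_rev.
apply: (can_inj revK); rewrite rev_descentK revK ew.
suff -> : v = [::] by rewrite cats0.
apply/eqP/negPn/negP; rewrite -size_eq0 -lt0n => v0.
have := neg_w (size v); rewrite -{2}[w]revK ew rev_cat take_size_cat ?size_rev //.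
have : size (rev w) = size w by rewrite size_rev.
have : height k (rev w) = height k w by rewrite height_rev.
rewrite ew size_cat !heightE height_descent // sz.
move=> hv szw.
have lt_v : 0 < size v <= size w by rewrite v0 -szw leq_addl.
by move/(_ lt_v); lia.
Qed.

Lemma rev_descent_inj rs rs' : excursions rs -> excursions rs' ->
  rev_descent rs = rev_descent rs' -> rs = rs'.
Proof.
move=> xrs xrs' e.
have sz : size rs = size rs'.
  by have := congr1 (height k) e; rewrite !height_rev_descent //; lia.
have := congr1 rev e; rewrite !rev_descentK -[LHS]cats0 -[RHS]cats0.
case/descent_inj; rewrite ?size_rev //; try exact: excursions_rev.
by move=> /(can_inj revK).
Qed.

(** The shortest nonempty prefix of height at least 0 ends with an up step,
because no other letter leads back from below the axis. A word starting with H
is excluded: its first letter is already such a prefix. *)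
Lemma crossing_split s w : s <> H -> (0 <= height k (s :: w))%R ->
  exists u v, [/\ s :: w = u ++ U :: v, negative k u
    & (0 <= height k u + k%:Z)%R].
Proof.
move=> sH hw; set X := s :: w.
have ex_i : exists i, [&& 0 < i, i <= size X & (0 <= height k (take i X))%R].
  by exists (size X); rewrite leqnn take_size.
have [[|i] // /and3P[_ lt_i hi] min_i] := ex_minnP ex_i.
(* i.+1 is the length of the shortest nonempty prefix of height >= 0. *)
have neg e : 0 < e <= i -> (height k (take e X) < 0)%R.
  move=> le_ei; rewrite ltNge; apply/negP => he.
  by have := min_i e; rewrite he; lia.
have eX : X = take i X ++ nth D X i :: drop i.+1 X.
  by rewrite -drop_nth // cat_take_drop.
have := hi; rewrite (take_nth D lt_i) -cats1 !heightE => hi'.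
have eU : nth D X i = U.
  case: (i) neg hi' => [_|j neg]; first by rewrite take0 heightE /=; case: (s) sH.
  by have := neg j.+1; case: (nth D X j.+1) => //=; lia.
exists (take i X), (drop i.+1 X); split; first by rewrite -eU.
  move=> e; rewrite (size_takel (ltnW lt_i)) => le_e.
  by rewrite take_takel ?neg //; lia.
by move: hi'; rewrite eU /=; lia.
Qed.

(** The marked up step ends the first nonempty prefix of height at least 0. *)
Lemma crossing_split_inj u v u' v' : negative k u -> negative k u' ->
  (0 <= height k u + k%:Z)%R -> (0 <= height k u' + k%:Z)%R ->
  u ++ U :: v = u' ++ U :: v' -> u = u' /\ v = v'.
Proof.
wlog le_u : u v u' v' / size u <= size u' => [wl|].
  move=> nu nu' hu hu' e; have [le_u|lt_u] := leqP (size u) (size u').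
    exact: wl.
  by have [] := wl _ _ _ _ (ltnW lt_u) nu' nu hu' hu (esym e).
move=> _ nu' hu _ /cat_split /(_ le_u) [[|s z] [eu' /=]].
  by case=> <-; rewrite eu' cats0.
case=> es _; have := nu' (size u).+1.
rewrite eu' -es -cat_rcons take_size_cat ?size_rcons // size_cat size_rcons.
by rewrite leq_addr -cats1 !heightE /=; lia.
Qed.

End Descent.

(** * The data common to both kinds of paths *)

(** In the notation of the decomposition of a path, [arcs] is R_1, ..., R_k,
[ascent] is P', [ending] is P'', and [flat] and [mark] are the number of
horizontal steps and the color of the hump. *)
Record parts := Parts {
  arcs : seq word;
  ascent : word;
  ending : word;
  flat : nat;
  mark : nat }.

Definition valid k d :=
  [/\ size (arcs d) = k /\ excursions k (arcs d), 1 <= mark d <= k.+1,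
      positive k (ascent d), ends_low k (ending d)
    & (height k (ascent d) + height k (ending d) = 0)%R].

Definition hump_glue d : colored_path :=
  let R1 := head [::] (arcs d) in
  ColoredPath
    (R1 ++ ascent d ++ U :: nseq (flat d) H ++ D ::
      descent (behead (arcs d)) ++ ending d)
    (size (R1 ++ ascent d)) (flat d) (mark d).

(** One formula covers the three color cases of [phi], since an empty list of
excursions gives the empty word. *)
Definition super_glue d : word :=
  nseq (flat d) H ++ rev_descent (take (mark d).-1 (arcs d)) ++
  U :: descent (drop (mark d).-1 (arcs d)) ++ ending d ++ ascent d.

Lemma perm_rev_descent rs : perm_eq (rev_descent rs) (descent rs).
Proof.
elim: rs => // R rs IH; apply/permP => p; rewrite descent_cons.
rewrite /rev_descent /= -/(rev_descent rs) !count_cat /= count_rev.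
by rewrite (permP IH) addnCA.
Qed.

Lemma perm_glue k d : 0 < k -> valid k d ->
  perm_eq (cword (hump_glue d)) (super_glue d).
Proof.
case: d => rs p q j c /= k0 [/= [sz _] _ _ _ _]; apply/permP => x.
rewrite /super_glue /= !count_cat /= !count_cat /= (permP (perm_rev_descent _)).
have : count x (descent rs) =
    count x (descent (take c.-1 rs)) + count x (descent (drop c.-1 rs)).
  by rewrite -count_cat -descent_cat cat_take_drop.
case: rs sz => [|R rs] sz; first by rewrite -sz in k0.
by rewrite descent_cons /= !count_cat /=; lia.
Qed.

Lemma super_path_perm k a n w w' :
  perm_eq w w' -> super_path k a n w -> super_path k a n w'.
Proof.
move=> ww' [al wd ht0]; split.
- by move=> /al; rewrite (perm_mem ww').
- by rewrite -wd /width (perm_big _ ww').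
- by rewrite -ht0 /height (perm_big _ ww').
Qed.

(** * Hump colored paths are glued from parts *)

(** Only nonnegativity needs an argument: after the hump the path descends from
height h + k to h through excursions, and P'' cannot go below its end, which is
the x-axis. *)
Lemma hump_glue_PM k n a d : 0 < k -> valid k d ->
  super_path k a n (super_glue d) -> PM k.+1 n k a (hump_glue d).
Proof.
move=> k0 vd sp; split; last by case: vd.
  split; first by apply: super_path_perm sp; rewrite perm_sym (perm_glue k0).
  suff /[swap] i : above k 0 (cword (hump_glue d)).
    by move/(_ i); rewrite GRing.add0r.
  case: d vd {sp} => [[|R rs] p q j c] [/= [sz xrs] _ pos low bal].
    by rewrite -sz in k0.
  have /excursions_cons[[R0 aR] xrs'] := xrs.
  have p0 := positive_above pos.
  have hp : (0 <= height k p)%R by have := p0 (size p); rewrite take_size; lia.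
  apply/above_cat; split=> //; rewrite R0 GRing.addr0.
  apply/above_cat; split=> //; apply/above_cons; split; first lia.
  apply/above_cat; split.
    by apply: above_weaken (proj2 (excursion_nseqH k j)); rewrite /=; lia.
  apply/above_cons; rewrite height_nseqH /=; split; first lia.
  apply/above_cat; split.
    apply: above_weaken (above_descent xrs').
    by move: sz hp => /=; lia.
  move=> i; rewrite height_descent //; have := low i; move: sz => /=; lia.
exists (head [::] (arcs d) ++ ascent d), (descent (behead (arcs d)) ++ ending d).
by rewrite /= catA.
Qed.

(** The minimum of the part before the hump is 0, since it is at most the height
of the origin; this makes R_1 an excursion and P' start on the x-axis. After the
hump the path still has to come down to height 0, which is at least k - 1 below.
*)
Lemma PM_hump_glue k n a P : 0 < k -> PM k.+1 n k a P ->
  exists2 d, valid k d & P = hump_glue d.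
Proof.
case: P => w l j c k0 [/= [[_ _ w0] aw] [u [v [szu ew]]] c_k].
have [R1 [p [eu low pos]]] := last_min_split k u.
have hR1 : height k R1 = 0%R.
  have := low 0; rewrite take0 heightE.
  by have := aw (size R1); rewrite ew eu -!catA take_size_cat //; lia.
have {}aw : above k 0 w by move=> i; rewrite GRing.add0r.
have : (height k v <= - k.-1%:Z)%R.
  move: w0; rewrite ew !heightE /=.
  have := aw (size u); rewrite ew take_size_cat //; lia.
case/descent_exists=> rs [q [szrs xrs ev]].
move: w0 aw; rewrite ew ev eu -!catA !heightE height_descent // hR1 /=.
move=> w0 /above_cat[aR1 /above_cat[_ /above_cons[_ /above_cat[_]]]].
case/above_cons=> _ /above_cat[_ aq].
have xrs1 : excursions k (R1 :: rs) by apply/excursions_cons.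
exists (Parts (R1 :: rs) p q j c); last first.
  by rewrite /hump_glue /= -szu eu.
split=> //=.
- by rewrite szrs prednK.
- move=> i; have := aq i; rewrite !heightE height_descent // hR1 szrs /=; lia.
- by move: w0; rewrite szrs; lia.
Qed.

(** * Super paths are glued from parts *)

Lemma nseqH_inj j j' w w' : ohead w <> Some H -> ohead w' <> Some H ->
  nseq j H ++ w = nseq j' H ++ w' -> j = j' /\ w = w'.
Proof.
elim: j j' => [|j IH] [|j'] hw hw' //=.
- by move=> e; rewrite e in hw.
- by move=> e; rewrite -e in hw'.
by case=> /IH []// -> ->.
Qed.

Lemma ohead_turn rs w : ohead (rev_descent rs ++ U :: w) <> Some H.
Proof. by case: rs. Qed.

Lemma super_glue_inj k d d' : valid k d -> valid k d' ->
  super_glue d = super_glue d' -> d = d'.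
Proof.
case: d d' => [rs p q j c] [rs' p' q' j' c'].
case=> [/= [sz xrs] ck pos low _] [/= [sz' xrs'] ck' pos' low' _].
rewrite /super_glue /= => /nseqH_inj[]; try exact: ohead_turn.
have xt : excursions k (take c.-1 rs) by move=> R /mem_take /xrs.
have xd : excursions k (drop c.-1 rs) by move=> R /mem_drop /xrs.
have xt' : excursions k (take c'.-1 rs') by move=> R /mem_take /xrs'.
have xd' : excursions k (drop c'.-1 rs') by move=> R /mem_drop /xrs'.
have szt : size (take c.-1 rs) = c.-1 by rewrite size_takel //; lia.
have szt' : size (take c'.-1 rs') = c'.-1 by rewrite size_takel //; lia.
move=> -> /(@crossing_split_inj k) [];
  rewrite ?height_rev_descent ?szt ?szt' //; try exact: rev_descent_negative.
- lia.
- lia.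
move=> /(rev_descent_inj xt xt') et.
have ec : c = c' by move: (congr1 size et); rewrite szt szt'; lia.
case/(descent_inj xd xd'); first by rewrite !size_drop sz sz' ec.
move=> ed /last_min_split_inj => /(_ k low pos low' pos') [-> ->].
by rewrite -(cat_take_drop c.-1 rs) et ed ec cat_take_drop.
Qed.

Lemma split_leading_H w : U \in w ->
  exists j s v, w = nseq j H ++ s :: v /\ s <> H.
Proof.
elim: w => // -[] w IH; try by [exists 0, U, w | exists 0, D, w].
rewrite inE /= => /IH [j [s [v [-> sH]]]].
by exists j.+1, s, v.
Qed.

(** The up step found by [crossing_split] starts at height - (c - 1) and ends at
height at least 0, which bounds c by k + 1. *)
Lemma S'_super_glue k n a w : S' n k a w ->
  exists2 d, valid k d & w = super_glue d.
Proof.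
case=> -[_ _ w0] /split_leading_H[j [s [v [ew sH]]]].
move: w0; rewrite ew height_cat height_nseqH GRing.add0r => w0.
have [|u [v' [ev neg hu]]] := @crossing_split k s v sH; first by rewrite w0.
have [rs1 x1 eu] := negative_rev_descent neg.
move: hu w0; rewrite ev eu !heightE height_rev_descent //= => hu w0.
have : (height k v' <= - (k - size rs1)%:Z)%R by lia.
case/descent_exists=> rs2 [T [sz2 x2 ev']].
move: w0; rewrite ev' heightE height_descent // => w0.
have [q [p [eT low pos]]] := last_min_split k T.
exists (Parts (rs1 ++ rs2) p q j (size rs1).+1).
  split=> //=.
  - split; first by rewrite size_cat sz2; lia.
    by move=> R; rewrite mem_cat => /orP[/x1|/x2].
  - by lia.
  - by move: w0; rewrite eT heightE; lia.
by rewrite /super_glue /= take_size_cat // drop_size_cat // eT.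
Qed.

(** * The map [phi] exchanges the two gluings *)

Lemma find_iota (p : pred nat) m n e : e < n -> p (m + e) ->
  (forall i, i < e -> ~~ p (m + i)) -> find p (iota m n) = e.
Proof.
move=> lt_en pe np; have -> : n = e + (n - e) by rewrite subnKC // ltnW.
rewrite iotaD find_cat size_iota.
case: ifP => [/hasP[x]|_].
  rewrite mem_iota => /andP[le_mx lt_x] px.
  by have /contraL := np (x - m); rewrite subnKC // px => /(_ isT); lia.
by case: (n - e) (subn_gt0 e n) => [|r]; rewrite ?lt_en //= pe addn0.
Qed.

Lemma last_filter_iota (p : pred nat) m l : m <= l -> p m ->
  (forall t, m < t <= l -> ~~ p t) ->
  last 0 [seq t <- iota 0 l.+1 | p t] = m.
Proof.
move=> le_ml ps np; have -> : l.+1 = m + (l - m).+1 by lia.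
rewrite iotaD filter_cat last_cat /= ps.
have -> // : [seq t <- iota (0 + m).+1 (l - m) | p t] = [::].
apply/eqP; rewrite -(negbK (_ == _)) -has_filter; apply/hasPn => t.
by rewrite mem_iota => ht; apply: np; lia.
Qed.

Section PhiGlue.

Variables (k : nat) (d : parts).
Hypotheses (k0 : 0 < k) (vd : valid k d).

Let R1 := head [::] (arcs d).
Let p := ascent d.
Let q := ending d.
Let w := cword (hump_glue d).
Let l := hpos (hump_glue d).
(* H^j is itself an excursion, so that everything between the up step of the
hump and P'' is a single descent, whose successive D's are d_1, ..., d_k. *)
Let drops := nseq (flat d) H :: behead (arcs d).

Let ex_drops : excursions k drops.
Proof.
apply/excursions_cons; split; first exact: excursion_nseqH.
by case: vd => -[_ xrs] _ _ _ _ R /mem_behead /xrs.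
Qed.

Let size_drops : size drops = k.
Proof. by case: vd => -[sz _] _ _ _ _; rewrite /= size_behead sz prednK. Qed.

Let wE : w = (R1 ++ p) ++ U :: descent drops ++ q.
Proof. by rewrite /w /= descent_cons -!catA. Qed.

Let height_R1 : height k R1 = 0%R.
Proof.
rewrite /R1; case: vd => -[_ xrs] _ _ _ _.
case: (arcs d) xrs => [|R rs] xrs; first by rewrite heightE.
by have [] := xrs R (mem_head _ _).
Qed.

Let start_ascent : start_P' k w l = size R1.
Proof.
apply: last_filter_iota; first by rewrite /l /= size_cat leq_addr.
  by rewrite /ht wE -!catA take_size_cat // height_R1.
move=> t /andP[lt_t le_t]; rewrite /ht wE takel_cat // take_cat ltnNge ltnW //=.
rewrite heightE height_R1 GRing.add0r.
have : (0 < height k (take (t - size R1) p))%R.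
  case: vd => _ _ pos _ _; apply: pos.
  by move: le_t; rewrite /l /= size_cat -/R1 -/p; lia.
by case: eqP => // ->.
Qed.

Let take_after e : e <= size (descent drops) ->
  ht k w (l.+1 + e) = (ht k w l + k%:Z + height k (take e (descent drops)))%R.
Proof.
move=> le_e; rewrite /ht wE addSnnS.
rewrite take_cat ltnNge leq_addr /= addKn /= takel_cat //.
by rewrite (@take_size_cat _ l (R1 ++ p)) // !heightE /=; lia.
Qed.

(* Before its last D, the descent through the first i + 1 excursions stays
strictly above its final level; so no earlier step arrives there. *)
Let dposE i : i < k ->
  dpos k w l i.+1 = l.+1 + (size (descent (take i drops)) + size (nth [::] drops i)).
Proof.
move=> lt_ik; have lt_i : i < size drops by rewrite size_drops.
set A := descent (take i drops); set R := nth [::] drops i.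
have xA : excursions k (take i drops) by move=> ? /mem_take /ex_drops.
have [hR _] : excursion k R by apply: ex_drops; apply: mem_nth.
have hA : height k A = (- i%:Z)%R.
  by rewrite height_descent // size_takel // ltnW.
have xAR : excursions k (take i.+1 drops) by move=> ? /mem_take /ex_drops.
have eAR : descent (take i.+1 drops) = A ++ R ++ [:: D].
  by rewrite (take_nth [::] lt_i) -cats1 descent_cat descent_cons.
have ed : descent drops = A ++ R ++ D :: descent (drop i.+1 drops).
  rewrite -{1}(cat_take_drop i.+1 drops) descent_cat eAR -!catA //.
have szd : size A + size R < size (descent drops).
  by rewrite ed !size_cat /=; lia.
rewrite /dpos; congr (_ + _); apply: find_iota.
- by rewrite wE !size_cat /= size_cat /l /= size_cat -/R1 -/p; lia.
- rewrite -addnS !take_after //; last exact: ltnW.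
  have -> : take (size A + size R).+1 (descent drops) = A ++ R ++ [:: D].
    rewrite ed -[D :: _]cat1s !catA take_size_cat // !size_cat /=; lia.
  have -> : take (size A + size R) (descent drops) = A ++ R.
    by rewrite ed catA take_size_cat // size_cat.
  by rewrite !heightE hA hR /=; apply/andP; split; apply/eqP; lia.
move=> e lt_e; rewrite negb_and; apply/orP; right.
have lt_e' : e.+1 < size (A ++ R ++ [:: D]) by rewrite !size_cat /=; lia.
have -> : (l.+1 + e).+1 = l.+1 + e.+1 by rewrite addnS.
rewrite take_after; last by lia.
have -> : take e.+1 (descent drops) = take e.+1 (A ++ R ++ [:: D]).
  by rewrite -eAR -{1}(cat_take_drop i.+1 drops) descent_cat takel_cat // eAR ltnW.
have := @descent_prefix k _ e.+1 xAR; rewrite eAR size_takel // => /(_ lt_e') h.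
by apply/eqP; lia.
Qed.

Let R_E i : 0 < i <= k -> R_ k w l i = nth [::] (arcs d) i.-1.
Proof.
case: i => // -[|i] le_ik; rewrite /R_ /=.
  by rewrite start_ascent wE -!catA take_size_cat // /R1 nth0.
rewrite !dposE //; last by lia.
have lt_i : i < size drops by rewrite size_drops; lia.
set A := descent (take i drops); set R := nth [::] drops i.
have -> : nth [::] drops i.+1 = nth [::] (arcs d) i.+1 by rewrite /= nth_behead.
set R' := nth [::] (arcs d) i.+1.
have szA : size (descent (take i.+1 drops)) = size A + (size R + 1).
  by rewrite (take_nth [::] lt_i) -cats1 descent_cat descent_cons !size_cat.
have ed : descent drops =
    descent (take i.+1 drops) ++ R' ++ D :: descent (drop i.+2 drops).
  rewrite -descent_cons; have -> : R' :: drop i.+2 drops = drop i.+1 drops.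
    by rewrite [RHS](drop_nth [::]) ?size_drops // /R' -nth_behead.
  by rewrite -descent_cat cat_take_drop.
have -> : (l.+1 + (size A + size R)).+1 =
    size ((R1 ++ p) ++ U :: descent (take i.+1 drops)).
  by rewrite size_cat -[size (R1 ++ p)]/l /= szA; lia.
have -> : l.+1 + (size (descent (take i.+1 drops)) + size R') =
    size (((R1 ++ p) ++ U :: descent (take i.+1 drops)) ++ R').
  by rewrite size_cat [in RHS]size_cat -[size (R1 ++ p)]/l /=; lia.
have -> : w = (((R1 ++ p) ++ U :: descent (take i.+1 drops)) ++ R') ++
    D :: descent (drop i.+2 drops) ++ q.
  by rewrite wE ed -!catA /= -!catA.
by rewrite /section take_size_cat // drop_size_cat.
Qed.

Let P''_E : P''_ k w l = q.
Proof.
have dk := @dposE k.-1; rewrite prednK // in dk.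
rewrite /P''_ dk //.
have lt_k : k.-1 < size drops by rewrite size_drops prednK.
have sz : size (descent drops) = size (descent (take k.-1 drops)) +
    (size (nth [::] drops k.-1)).+1.
  rewrite -{1}(take_size drops) size_drops -{1}(prednK k0).
  by rewrite (take_nth [::] lt_k) -cats1 descent_cat descent_cons !size_cat addn1.
rewrite wE -cat_cons catA drop_size_cat //.
have szU : size (U :: descent drops) = (size (descent drops)).+1 by [].
by rewrite size_cat -[size (R1 ++ p)]/l szU sz; lia.
Qed.

Let P'_E : P'_ k w l = p.
Proof.
rewrite /P'_ /section start_ascent wE take_size_cat // drop_size_cat //.
Qed.

Let R_section m t : 0 < m -> t <= k ->
  [seq R_ k w l i | i <- index_iota m t.+1] = drop m.-1 (take t (arcs d)).
Proof.
move=> m0 le_tk; have sz : size (arcs d) = k by case: vd => -[].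
apply: (@eq_from_nth _ [::]).
  by rewrite size_map size_iota size_drop size_takel ?sz //; lia.
move=> i; rewrite size_map size_iota => lt_i.
rewrite (nth_map 0) ?size_iota // nth_iota // R_E; last by lia.
by rewrite nth_drop nth_take -?predn_sub; [congr nth|]; lia.
Qed.

Let blocksE m : 0 < m ->
  blocks k w l m k.+1 = descent (drop m.-1 (arcs d)).
Proof.
move=> m0; rewrite /blocks (map_comp (rcons^~ D) (R_ k w l)) R_section //.
by rewrite take_oversize //; case: vd => -[->].
Qed.

Let rev_blocksE t : 0 < t <= k.+1 ->
  rev_blocks k w l 1 t = rev_descent (take t.-1 (arcs d)).
Proof.
case: t => // t lt_t.
by rewrite /rev_blocks (map_comp (fun R => D :: rev R) (R_ k w l)) R_section ?drop0.
Qed.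

(** With the sections of the word identified, the cases c = 1 and c = k + 1 are
the general case with an empty descent on one side of the up step. *)
Lemma phi_hump_glue : phi k (hump_glue d) = super_glue d.
Proof.
have [[sz _] c_k _ _ _] := vd.
have -> : phi k (hump_glue d) = nseq (flat d) H ++
    (if mark d == 1 then U :: blocks k w l 1 k.+1
     else if mark d == k.+1 then rcons (rev_blocks k w l 1 k.+1) U
     else rev_blocks k w l 1 (mark d) ++ U :: blocks k w l (mark d) k.+1) ++
    P''_ k w l ++ P'_ k w l by [].
rewrite P''_E P'_E /super_glue; congr (_ ++ _).
case: eqP => [->|c1]; first by rewrite blocksE // drop0 take0.
case: eqP => [->|ck]; last by rewrite rev_blocksE ?blocksE -?catA //; lia.
by rewrite rev_blocksE ?ltnSn //= -cats1 -catA drop_oversize ?sz.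
Qed.

End PhiGlue.

Lemma super_glue_starts d : starts_with_exactly (flat d) (super_glue d).
Proof. by eexists; split; [reflexivity|exact: ohead_turn]. Qed.

Theorem theorem2p4 (k n : nat) (a : option nat)
    (hk : (1 <= k)%N) (hn : (1 <= n)%N) (ha : a <> Some 0%N) :
  set_bij (PM k.+1 n k a) (S' n k a) (phi k) /\
  (forall P : colored_path, PM k.+1 n k a P ->
     starts_with_exactly (hlen P) (phi k P)).
Proof.
split; last first.
  move=> P /(PM_hump_glue hk)[d vd ->]; rewrite phi_hump_glue //.
  exact: super_glue_starts.
split.
- move=> P PM_P; have [d vd eP] := PM_hump_glue hk PM_P.
  rewrite eP phi_hump_glue //; split.
    case: PM_P => -[sp _] _ _.
    by apply: super_path_perm sp; rewrite eP; apply: perm_glue vd.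
  by rewrite !mem_cat inE eqxx !orbT.
- move=> P Q /set_mem/(PM_hump_glue hk)[d vd ->].
  move=> /set_mem/(PM_hump_glue hk)[d' vd' ->].
  by rewrite !phi_hump_glue // => /(super_glue_inj vd vd') ->.
- move=> w Sw; have [d vd ew] := S'_super_glue Sw.
  exists (hump_glue d); last by rewrite phi_hump_glue.
  by apply: hump_glue_PM => //; rewrite -ew; case: Sw.
Qed.
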